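(* Let $a:\mathbb Z^d\to\mathbb R$ satisfy $a(z)\ge 0$ and $a(z)=a(-z)$ for $z\ne 0$, $\sum_{z\ne 0}a(z)=1$, $a(0)=-1$, with the set $\{z:a(z)>0\}$ spanning $\mathbb Z^d$. Let $k_0,\beta_0,\mu_0,u_0,\tilde u_0$ be real constants with $v_0:=\mu_0-\beta_0>0$, $k_0>0$, $u_0>0$, $\tilde u_0>0$, and fix $\varepsilon>0$. Suppose that for all $x,y\in\mathbb Z^d$ $$v_0-\varepsilon\le v(x)\le v_0+\varepsilon,\qquad k_0-\varepsilon\le k(x)\le k_0+\varepsilon,$$ $$u_0-\varepsilon\le u_0(x)\le u_0+\varepsilon,\qquad \tilde u_0-\varepsilon\le u_0(x,y)\le \tilde u_0+\varepsilon,$$ and let $m_1(t,x)$ be the solution, bounded on $[0,T]\times\mathbb Z^d$ for every $T>0$, of $$\frac{\partial m_1(t,x)}{\partial t}=\sum_{z\ne 0}a(z)\bigl(m_1(t,x+z)-m_1(t,x)\bigr)-v(x)m_1(t,x)+k(x),\qquad m_1(0,x)=u_0(x).$$ Then there are constants $C_0^{\pm},C_1^{\pm}$ (not depending on $t$ and $x$) such that for any $t\ge 0$ and all $x\in\mathbb Z^d$ $$C_1^-\varepsilon+C_0^-e^{-(v_0+\varepsilon)t}\le m_1(t,x)-\frac{k_0}{v_0}\le C_1^+\varepsilon+C_0^+e^{-(v_0-\varepsilon)t}.$$ Moreover, if $\varepsilon\le\frac{\min(k_0,v_0)}{2}$, the constants $C_0^{\pm},C_1^{\pm}$ depend only on 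$k_0,v_0,u_0$.
   Context: The function $m_1(t,x)=\mathsf E\,n(t,x)$ is the mean number of particles at time $t$ and site $x$ in a continuous-time branching random walk with immigration on $\mathbb Z^d$. Here $v(x)=\mu(x)-\beta(x)$, where $\mu(x)$ is the death rate and $\beta(x)=\sum_{n\ge2}(n-1)b_n(x)$ the birth rate at $x$ ($b_n(x)$ being the intensity with which a particle at $x$ turns into $n$ particles); $k(x)$ is the immigration rate at $x$; $u_0(x)=\mathsf E\,n(0,x)$ is the initial first moment; and $u_0(x,y)=\mathsf E[n(0,x)n(0,y)]$ is the initial second moment, which does not enter the equation for $m_1$. The symbols $u_0$ and $\tilde u_0$ without argument denote constants; $u_0(x)$ and $u_0(x,y)$ denote functions.
   Formalization: The upper bound is stated only for ε ≠ v_0: at ε = v_0 it fails, e.g. for v(x)=0, k(x)=k_0, u_0(x)=u_0, where m_1 = u_0 + k_0 t grows linearly; the lower bound and the ''moreover'' part are unaffected. *)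

(* Defs.v *)
From HB Require Import structures.
From mathcomp Require Import all_boot all_order all_algebra.
From mathcomp Require Import all_classical all_reals all_analysis.
Set Implicit Arguments.
Unset Strict Implicit.
Unset Printing Implicit Defensive.
Import Order.TTheory GRing.Theory Num.Theory.
Import numFieldNormedType.Exports.

Local Open Scope classical_set_scope.
Local Open Scope ring_scope.

(* [\esum] is meant for nonnegative terms only, hence the split into positive
   and negative parts. The value is meaningful for absolutely summable [f]. *)
Definition real_sum (R : realType) (T : choiceType) (D : set T) (f : T -> R) : R :=
  fine (
    \esum_(z in D) (Num.max (f z) 0)%R%:E - \esum_(z in D) (Num.max (- f z) 0)%R%:E)%E.

Record jump_kernel (R : realType) (d : nat) (a : 'rV[int]_d -> R) : Prop := {
  jump_ge0 : forall z, z != 0 -> 0 <= a z;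
  jump_sym : forall z, z != 0 -> a z = a (- z);
  jump_sum1 : (\esum_(z in [set z | z != 0%R]) (a z)%:E = 1)%E;
  jump_at0 : a 0 = -1;
  (* [inIntSpan s x]: x is a linear combination of s with integer coefficients *)
  jump_span : forall x, exists m (s : m.-tuple 'rV[int]_d),
    (forall z, z \in s -> 0 < a z) /\ inIntSpan s x }.

Record brwi (R : realType) (d : nat) := {
  jump_rate : 'rV[int]_d -> R;
  jump_rateP : jump_kernel jump_rate;
  death_rate : 'rV[int]_d -> R;
  death_rate_ge0 : forall x, 0 <= death_rate x;
  (* [split_rate n x]: intensity with which a particle at x turns into n particles;
     only the values n >= 2 are used *)
  split_rate : nat -> 'rV[int]_d -> R;
  split_rate_ge0 : forall n x, (2 <= n)%N -> 0 <= split_rate n x;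
  birth_rate : 'rV[int]_d -> R;
  birth_rateE : forall x,
    ((birth_rate x)%:E = \sum_(2 <= n <oo) ((n.-1)%:R * split_rate n x)%R%:E)%E;
  immigration_rate : 'rV[int]_d -> R;
  immigration_rate_ge0 : forall x, 0 <= immigration_rate x;
  brwi_display : measure_display;
  brwi_Omega : measurableType brwi_display;
  brwi_prob : probability brwi_Omega R;
  init_field : 'rV[int]_d -> {mfun brwi_Omega >-> nat};
  init_mean : 'rV[int]_d -> R;
  init_meanE : forall x,
    ((init_mean x)%:E = 'E_brwi_prob[(fun w => (init_field x w)%:R)%R])%E;
  init_mean2 : 'rV[int]_d -> 'rV[int]_d -> R;
  init_mean2E : forall x y,
    ((init_mean2 x y)%:E =
      'E_brwi_prob[(fun w => (init_field x w)%:R * (init_field y w)%:R)%R])%E }.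

Definition net_death (R : realType) (d : nat) (B : brwi R d) (x : 'rV[int]_d) : R :=
  death_rate B x - birth_rate B x.

Definition near_homogeneous (R : realType) (d : nat) (B : brwi R d)
    (v0 k0 u0 tu0 eps : R) : Prop :=
  forall x y : 'rV[int]_d,
    [/\ v0 - eps <= net_death B x <= v0 + eps,
        k0 - eps <= immigration_rate B x <= k0 + eps,
        u0 - eps <= init_mean B x <= u0 + eps &
        tu0 - eps <= init_mean2 B x y <= tu0 + eps].

(* The time variable ranges over R, but only nonnegative times are constrained.
   By boundedness and the equation, right-continuity at 0 together with the
   equation for t > 0 gives the one-sided equation at t = 0. *)
Record first_moment_solution (R : realType) (d : nat) (B : brwi R d)
    (m1 : R -> 'rV[int]_d -> R) : Prop := {
  fms_bounded : forall T : R, 0 < T ->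
    exists M : R, forall (t : R) x, 0 <= t <= T -> `|m1 t x| <= M;
  fms_continuous : forall x, {within `[0, +oo[, continuous (m1 ^~ x : R -> R)};
  fms_equation : forall (t : R) x, 0 < t ->
    is_derive t (1 : R) (m1 ^~ x : R -> R)
      (real_sum [set z | z != 0] (fun z => jump_rate B z * (m1 t (x + z) - m1 t x))
       - net_death B x * m1 t x + immigration_rate B x);
  fms_initial : forall x, m1 0 x = init_mean B x }.

(* Main.v *)
(* Comparison with solutions that are constant in space.  With the extreme
   values of v, k and u0 as coefficients, the equation restricted to functions
   of t alone is a linear ODE whose solution relaxes exponentially to k/v.  As
   this solution is nonnegative, it is a sub- or supersolution of the original
   equation.  The comparison principle on the infinite lattice comes from a
   contraction: if w >= - K e^(lam t) for a supersolution w, then integrating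
   the equation once at each site yields the same bound with K / 2. *)
Require Import Defs.
From HB Require Import structures.
From mathcomp Require Import all_boot all_order all_algebra.
From mathcomp Require Import all_classical all_reals all_analysis.
From mathcomp Require Import ring lra.
Set Implicit Arguments.
Unset Strict Implicit.
Unset Printing Implicit Defensive.
Import Order.TTheory GRing.Theory Num.Theory.
Import numFieldNormedType.Exports.
Local Open Scope ring_scope.

(** * Sums weighted by a kernel of total mass 1 *)

Lemma esum_maxr_le (R : realType) (T : choiceType) (D : set T) (a f : T -> R)
    (c : R) :
  0 <= c -> (forall z, D z -> 0 <= a z) ->
  (\esum_(z in D) (a z)%:E = 1)%E -> (forall z, D z -> f z <= c * a z) ->
  (\esum_(z in D) (Num.max (f z) 0)%:E <= c%:E)%E.
Proof.
move=> c0 a0 a1 fa; apply: ge_ereal_sup => _ [X [Xfin XD] <-].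
rewrite fsumEFin// lee_fin.
apply: (@le_trans _ _ (\sum_(z \in X) c * a z)).
  rewrite !fsbig_finite//= big_seq [leRHS]big_seq; apply: ler_sum => z.
  rewrite in_fset_set// inE => /XD Dz.
  by rewrite ge_max fa// mulr_ge0// a0.
rewrite -mulr_fsumr -[leRHS]mulr1 ler_wpM2l//.
rewrite -lee_fin -fsumEFin// -a1.
by apply: esum_ge; exists X.
Qed.

(** The positive and negative parts sum to at most [c] and [b], so both sums are finite and [fine]
    does not fall back on its default value. Both being nonnegative, neither can push the difference
    past the other's bound. *)
Lemma real_sum_itv (R : realType) (T : choiceType) (D : set T) (a f : T -> R)
    (b c : R) :
  0 <= b -> 0 <= c -> (forall z, D z -> 0 <= a z) ->
  (\esum_(z in D) (a z)%:E = 1)%E ->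
  (forall z, D z -> - b * a z <= f z <= c * a z) ->
  - b <= real_sum D f <= c.
Proof.
move=> b0 c0 a0 a1 fa; rewrite /real_sum.
have := @esum_maxr_le R T D a f c c0 a0 a1 (fun z Dz => proj2 (andP (fa z Dz))).
have : (\esum_(z in D) (Num.max (- f z) 0)%:E <= b%:E)%E.
  apply: (esum_maxr_le b0 a0 a1) => z /fa/andP[fb _].
  by rewrite lerNl -mulNr.
have : (0 <= \esum_(z in D) (Num.max (f z) 0)%:E)%E.
  by apply: esum_ge0 => z _; rewrite lee_fin le_max lexx orbT.
have : (0 <= \esum_(z in D) (Num.max (- f z) 0)%:E)%E.
  by apply: esum_ge0 => z _; rewrite lee_fin le_max lexx orbT.
case: (\esum_(z in D) (Num.max (f z) 0)%:E)%E => [p| |] //.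
case: (\esum_(z in D) (Num.max (- f z) 0)%:E)%E => [q| |] //=.
rewrite !lee_fin; lra.
Qed.

Lemma jump_sum_itv (R : realType) (d : nat) (a m : 'rV[int]_d -> R)
    (c C : R) (x : 'rV[int]_d) :
  jump_kernel a -> (forall y, c <= m y <= C) ->
  c - m x <= real_sum [set z | z != 0] (fun z => a z * (m (x + z) - m x))
    <= C - m x.
Proof.
move=> aP mcC; have /andP[cx xC] := mcC x.
rewrite -[c - _]opprB.
apply: (@real_sum_itv R _ _ a); rewrite ?subr_ge0//.
- exact: jump_ge0 aP.
- exact: jump_sum1 aP.
- move=> z /(jump_ge0 aP) az; have /andP[cz zC] := mcC (x + z).
  by rewrite !(mulrC _ (a z)) !ler_wpM2l//; lra.
Qed.

(** * Comparison principle for supersolutions *)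

Section supersolution.
Variables (R : realType) (V : Type) (w w' : R -> V -> R) (v : V -> R).
Hypothesis w_cont : forall x, {within `[0, +oo[, continuous (w ^~ x)}%classic.
Hypothesis w_derive : forall (t : R) x, 0 < t -> is_derive t (1 : R) (w ^~ x) (w' t x).
(* The jump operator enters only through: (A w)(t, x) >= - K - w t x whenever
   w t >= - K. *)
Hypothesis w_super : forall (t : R) x K, 0 < t -> (forall y, - K <= w t y) ->
  - K - (1 + v x) * w t x <= w' t x.
Hypothesis w_init : forall x, 0 <= w 0 x.

Lemma supersolution_halve (T K lam : R) :
  0 <= K -> (forall x, 1 - v x <= lam) ->
  (forall (t : R) x, 0 <= t <= T -> - (K * expR (lam * t)) <= w t x) ->
  forall (t : R) x, 0 <= t <= T -> - (K / 2 * expR (lam * t)) <= w t x.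
Proof.
move=> K0 lamP wK t x /andP[t0 tT].
pose E c (s : R) := expR (c * s).
have dE c (s : R) : is_derive s (1 : R) (E c) (c * E c s).
  have := @is_derive1_comp R expR ( *%R c) s _ c (is_derive_expR _).
  rewrite mulrC; apply.
  have := @is_deriveZ R _ _ id c s 1 1 (is_derive_id _ _).
  by rewrite /GRing.scale /= mulr1.
have cE c : {within `[0, t], continuous (E c)}%classic.
  by apply: derivable_within_continuous => s _; have [] := dE c s.
(* The integrating factor absorbs the loss term [(1 + v x) * w]. The claim amounts to [0 <= h t],
   and [h 0] is nonnegative, so it is enough that [h] is nondecreasing. *)
pose h : R -> R := E (1 + v x) * ((w ^~ x) + (K / 2) *: E lam).
have dh (s : R) : 0 < s -> is_derive s (1 : R) h
    (E (1 + v x) s * (w' s x + K / 2 * (lam * E lam s))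
     + (w s x + K / 2 * E lam s) * ((1 + v x) * E (1 + v x) s)).
  move=> s0.
  exact: is_deriveM (dE _ _) (is_deriveD (w_derive x s0) (is_deriveZ _ (dE _ _))).
have hE s : h s = E (1 + v x) s * (w s x + K / 2 * E lam s) by [].
suff : h 0 <= h t.
  rewrite !hE /E !mulr0 expR0 mul1r mulr1.
  have := w_init x => w0 /(le_trans (addr_ge0 w0 (divr_ge0 K0 _))).
  rewrite pmulr_rge0 ?expR_gt0// => /(_ (ler0n _ _)); lra.
have I0 : (0 : R) \in `[0, t] by rewrite in_itv /= lexx t0.
have It : t \in `[0, t] by rewrite in_itv /= lexx t0.
apply: (ger0_derive1_le_cc _ _ _ I0 It t0) => [s|s|].
- by rewrite in_itv /= => /andP[/dh[]].
- rewrite in_itv /= => /andP[s0 st].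
  have dhs := dh s s0; rewrite derive1E derive_val.
  have := @w_super s x (K * expR (lam * s)) s0
    (fun y => wK s y _) => /(_ ltac:(by rewrite (ltW s0) (le_trans (ltW st) tT))).
  have := lamP x; rewrite -/(E lam s).
  have : 0 < E lam s by exact: expR_gt0.
  have : 0 < E (1 + v x) s by exact: expR_gt0.
  move: (E (1 + v x) s) (E lam s) => e f e0 f0 l ws.
  rewrite (_ : _ + _ = e * (w' s x + K / 2 * (lam * f)
     + (w s x + K / 2 * f) * (1 + v x))); last by ring.
  apply: mulr_ge0; first exact: ltW.
  (* By [w_super] the bracket is at least half of this product; this is where halving [K] requires
     [lam >= 1 - v x]. *)
  have : 0 <= K * f * (lam - (1 - v x)) by rewrite !mulr_ge0 ?(ltW f0)// subr_ge0.
  nra.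
- move=> s; apply: cvgM; first exact: cE.
  apply: cvgD; last by apply: cvgZr; exact: cE.
  apply: continuous_subspaceW (w_cont (x:=x)) s.
  by move=> u; rewrite /= !in_itv /= => /andP[->].
Qed.

(** Repeated halving of the crude bound drives it to 0. The lower bound on [v] provides one rate
    [lam] for all sites, hence for all iterations. *)
Lemma supersolution_ge0 (T M b : R) :
  (forall x, b <= v x) -> (forall (t : R) x, 0 <= t <= T -> - M <= w t x) ->
  forall (t : R) x, 0 <= t <= T -> 0 <= w t x.
Proof.
move=> bv wM t x tT.
(* The maximum with 0 makes [expR (lam * s) >= 1], so the bound by [M] starts the induction. *)
pose lam := Num.max (1 - b) 0.
have lamP y : 1 - v y <= lam by rewrite le_max lerB.
have lam0 : 0 <= lam by rewrite le_max lexx orbT.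
have iter n s y : 0 <= s <= T -> - (`|M| / 2 ^+ n * expR (lam * s)) <= w s y.
  elim: n s y => [|n IHn] s y sT.
    rewrite expr0 divr1; apply: le_trans (wM s y sT); rewrite lerN2.
    apply: le_trans (ler_norm _) _; rewrite ler_peMr// -expR0 ler_expR.
    by case/andP: sT => s0 _; rewrite mulr_ge0.
  rewrite exprSr invfM mulrA.
  by apply: (supersolution_halve _ lamP IHn) => //; rewrite divr_ge0.
rewrite leNgt; apply/negP => wn.
(* A negative value is refuted by [n] with [2 ^- n < - w t x / c]; the added 1 makes [c] positive
   even if [M = 0]. *)
pose c := `|M| * expR (lam * t) + 1.
have c0 : 0 < c by rewrite ltr_wpDl// mulr_ge0// expR_ge0.
have e0 : 0 < - w t x / c by rewrite divr_gt0// oppr_gt0.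
have [n _ /(_ n (leqnn n)) /=] := near_infty_natSinv_expn_lt (PosNum e0).
rewrite ltr_pdivlMr// div1r => cw.
have := iter n t x tT; rewrite lerNl leNgt => /negP; apply.
apply: lt_trans cw.
rewrite (mulrC `|M|) -mulrA ltr_pM2l ?invr_gt0 ?exprn_gt0//.
by rewrite /c ltrDl.
Qed.

End supersolution.

(* The solution of [y' = K - r y], [y 0 = U], for [r != 0]. *)
Definition relax (R : realType) (K U r t : R) : R :=
  K / r + (U - K / r) * expR (- r * t).

(** * Derivative and sign of the spatially constant solutions *)

Section relax.
Context {R : realType}.
Implicit Types K U r t : R.

Lemma relax0 K U r : relax K U r 0 = U.
Proof. by rewrite /relax mulr0 expR0 mulr1 addrC subrK. Qed.

Lemma is_derive_relax K U r t : r != 0 ->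
  is_derive t (1 : R) (relax K U r) (K - r * relax K U r t).
Proof.
move=> r0.
have dr : is_derive t (1 : R) ( *%R (- r)) (- r).
  have := @is_deriveZ R _ _ id (- r) t 1 1 (is_derive_id _ _).
  by rewrite /GRing.scale /= mulr1.
have de := is_derive1_comp (is_derive_expR (- r * t)) dr.
have : is_derive t (1 : R) (relax K U r) _ :=
  is_deriveD (is_derive_cst (K / r) t (1 : R)) (is_deriveZ (U - K / r) de).
move=> /is_derive_eq; apply.
by rewrite /relax /GRing.scale /=; field.
Qed.

(** The factor [(1 - expR (- r * t)) / r] of [K] is nonnegative for either sign of [r]. Negative [r]
    occurs in the upper bound when [eps > v0]. *)
Lemma relax_ge0 K U r t : 0 <= K -> 0 <= U -> 0 <= t -> 0 <= relax K U r t.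
Proof.
move=> K0 U0 t0.
rewrite (_ : relax K U r t = U * expR (- r * t) + K * ((1 - expR (- r * t)) / r));
  last by rewrite /relax; ring.
apply: addr_ge0; first by rewrite mulr_ge0// expR_ge0.
apply: mulr_ge0 => //.
have [r0|r0] := leP 0 r.
  rewrite divr_ge0// subr_ge0 -expR0 ler_expR mulNr oppr_le0.
  exact: mulr_ge0.
rewrite ler_ndivlMr// mul0r subr_le0 -expR0 ler_expR mulr_ge0//.
by rewrite oppr_ge0 ltW.
Qed.

End relax.

(** * Comparison of the first moment with [relax] *)

Section comparison.
Variables (R : realType) (d : nat) (B : brwi R d) (m1 : R -> 'rV[int]_d -> R).
Hypothesis m1P : first_moment_solution B m1.
Variables (b K U r : R).
Hypotheses (bv : forall x, b <= net_death B x) (K0 : 0 <= K) (U0 : 0 <= U).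
Hypothesis r0 : r != 0.

Let relax_cont : {within `[0, +oo[, continuous (relax K U r)}%classic.
Proof.
by apply: derivable_within_continuous => t _; have [] := is_derive_relax K U t r0.
Qed.

Lemma first_moment_ge_relax :
  (forall x, [/\ net_death B x <= r, K <= immigration_rate B x &
    U <= init_mean B x]) ->
  forall (t : R) x, 0 <= t -> relax K U r t <= m1 t x.
Proof.
move=> BP t x t0; rewrite -subr_ge0.
pose w : R -> 'rV[int]_d -> R := fun s y => m1 s y - relax K U r s.
pose w' : R -> 'rV[int]_d -> R := fun s y =>
  (real_sum [set z | z != 0]%classic
     (fun z => jump_rate B z * (m1 s (y + z) - m1 s y))
   - net_death B y * m1 s y + immigration_rate B y) - (K - r * relax K U r s).
rewrite -/(w t x).
(* The horizon is [t + 1] because [fms_bounded] asks for a positive one and [t] may be 0. *)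
have tT : 0 <= t <= t + 1 by rewrite t0 lerDl ler01.
have [M mM] := fms_bounded m1P (ltr_wpDl t0 ltr01).
have [N rN] : exists N, forall s : R, 0 <= s <= t + 1 -> relax K U r s <= N.
  have t1 : 0 <= t + 1 by lra.
  have rc : {within `[0, t + 1], continuous (relax K U r)}%classic.
    apply: continuous_subspaceW relax_cont.
    by move=> u; rewrite /= !in_itv /= => /andP[->].
  by have [c _ cP] := EVT_max t1 rc; exists (relax K U r c) => s /cP.
refine (@supersolution_ge0 R _ w w' (net_death B) _ _ _ _ (t + 1) (M + N) b
  bv _ t x tT).
- move=> y s; apply: cvgB; [exact: (fms_continuous m1P)|exact: relax_cont].
- move=> s y s0.
  exact: is_deriveB (fms_equation m1P y s0) (is_derive_relax K U s r0).
- move=> s y L s0 wL; rewrite /w /w'.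
  have [M' mM'] := fms_bounded m1P s0.
  (* [- L <= w s] bounds [m1 s] below by [relax K U r s - L] at every site; [M'] supplies the upper
     bound that keeps the jump sum finite. *)
  have /andP[+ _] := @jump_sum_itv R d (jump_rate B) (m1 s) (relax K U r s - L) M'
    y (jump_rateP B) ltac:(move=> z; have := wL z; have := mM' s z;
      rewrite (ltW s0) lexx /w => /(_ isT); rewrite ler_norml => /andP[_ ->] ?;
      rewrite andbT; lra).
  have [vr kK _] := BP y.
  have : 0 <= (r - net_death B y) * relax K U r s.
    by rewrite mulr_ge0 ?subr_ge0// relax_ge0 ?(ltW s0).
  lra.
- by move=> y; rewrite /w relax0 (fms_initial m1P) subr_ge0; have [] := BP y.
- move=> s y st; have := mM s y st; rewrite ler_norml => /andP[Mm _].
  by rewrite opprD lerD// lerN2 rN.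
Qed.

Lemma first_moment_le_relax :
  (forall x, [/\ r <= net_death B x, immigration_rate B x <= K &
    init_mean B x <= U]) ->
  forall (t : R) x, 0 <= t -> m1 t x <= relax K U r t.
Proof.
move=> BP t x t0; rewrite -subr_ge0.
pose w : R -> 'rV[int]_d -> R := fun s y => relax K U r s - m1 s y.
pose w' : R -> 'rV[int]_d -> R := fun s y =>
  (K - r * relax K U r s) - (real_sum [set z | z != 0]%classic
     (fun z => jump_rate B z * (m1 s (y + z) - m1 s y))
   - net_death B y * m1 s y + immigration_rate B y).
rewrite -/(w t x).
have tT : 0 <= t <= t + 1 by rewrite t0 lerDl ler01.
have [M mM] := fms_bounded m1P (ltr_wpDl t0 ltr01).
refine (@supersolution_ge0 R _ w w' (net_death B) _ _ _ _ (t + 1) M b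
  bv _ t x tT).
- move=> y s; apply: cvgB; [exact: relax_cont|exact: (fms_continuous m1P)].
- move=> s y s0.
  exact: is_deriveB (is_derive_relax K U s r0) (fms_equation m1P y s0).
- move=> s y L s0 wL; rewrite /w /w'.
  have [M' mM'] := fms_bounded m1P s0.
  have /andP[_] := @jump_sum_itv R d (jump_rate B) (m1 s) (- M') (relax K U r s + L)
    y (jump_rateP B) ltac:(move=> z; have := wL z; have := mM' s z;
      rewrite (ltW s0) lexx /w => /(_ isT); rewrite ler_norml => /andP[-> _] ? /=;
      lra).
  have [vr kK _] := BP y.
  have : 0 <= (net_death B y - r) * relax K U r s.
    by rewrite mulr_ge0 ?subr_ge0// relax_ge0 ?(ltW s0).
  lra.
- by move=> y; rewrite /w relax0 (fms_initial m1P) subr_ge0; have [] := BP y.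
(* Since [relax] is nonnegative, the bound [M] on [m1] alone gives [- M <= w]. *)
- move=> s y st; have := mM s y st; rewrite ler_norml => /andP[_ mM1].
  have /andP[s0 _] := st.
  by rewrite /w addrC -[leLHS]addr0 lerD ?lerN2// relax_ge0.
Qed.

End comparison.

Lemma init_mean_ge0 (R : realType) (d : nat) (B : brwi R d) x : 0 <= init_mean B x.
Proof. by rewrite -lee_fin init_meanE expectation_ge0. Qed.

(* D0m, D1m, D0p, D1p express the dependence on (k0, v0, u0) only. The upper
   bound fails for eps = v0 (e.g. v = 0, k = k0, where m1 grows linearly). *)
Theorem theorem7p1 (R : realType) :
  exists D0m D1m D0p D1p : R -> R -> R -> R,
  forall (d : nat) (B : brwi R d) (k0 beta0 mu0 u0 tu0 eps : R)
    (m1 : R -> 'rV[int]_d -> R),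
  let v0 := mu0 - beta0 in
  0 < v0 -> 0 < k0 -> 0 < u0 -> 0 < tu0 -> 0 < eps ->
  near_homogeneous B v0 k0 u0 tu0 eps ->
  first_moment_solution B m1 ->
  exists C0m C1m C0p C1p : R,
    (forall (t : R) x, 0 <= t ->
       C1m * eps + C0m * expR (- (v0 + eps) * t) <= m1 t x - k0 / v0 /\
       (eps <> v0 ->
        m1 t x - k0 / v0 <= C1p * eps + C0p * expR (- (v0 - eps) * t))) /\
    (eps <= Num.min k0 v0 / 2 ->
       [/\ C0m = D0m k0 v0 u0, C1m = D1m k0 v0 u0,
           C0p = D0p k0 v0 u0 & C1p = D1p k0 v0 u0]).
Proof.
(* The [eps] coefficients come from [k/v - (k-eps)/(v+eps) = eps (v+k) / (v (v+eps))] and its mirror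
   image with [v - eps], where [v - eps >= v/2] costs the factor 2. The term [v / 2] bounds
   [eps]. *)
exists (fun k v _ => - (k / v)), (fun k v _ => - ((v + k) / v ^+ 2)),
  (fun _ v u => u + v / 2), (fun k v _ => 2 * (v + k) / v ^+ 2).
move=> d B k0 beta0 mu0 u0 tu0 eps m1 v0 v0_gt0 k0_gt0 u0_gt0 _ eps_gt0 BP m1P.
move: v0 v0_gt0 BP => v0 v0_gt0 BP.
have bv x : v0 - eps <= net_death B x by have [/andP[]] := BP x x.
have ke0 : 0 <= k0 + eps by rewrite ltW// addr_gt0.
have ue0 : 0 <= u0 + eps by rewrite ltW// addr_gt0.
(* Both u0 - eps and k0 - eps may be negative, so the subsolution starts from 0
   with immigration truncated at 0. *)
have lower t x : 0 <= t -> - ((v0 + k0) / v0 ^+ 2) * eps +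
    - (k0 / v0) * expR (- (v0 + eps) * t) <= m1 t x - k0 / v0.
  move=> t0; pose K := Num.max (k0 - eps) 0.
  have r_gt0 : 0 < v0 + eps by rewrite addr_gt0.
  have K0 : 0 <= K by rewrite le_max lexx orbT.
  have : relax K 0 (v0 + eps) t <= m1 t x.
    apply: (first_moment_ge_relax m1P bv K0 (lexx 0) (lt0r_neq0 r_gt0) _ x t0).
    move=> y; have [/andP[_ vy] /andP[ky _] _ _] := BP y y; split => //.
      by rewrite ge_max ky immigration_rate_ge0.
    exact: init_mean_ge0.
  rewrite lerBrDr => /(le_trans _); apply.
  rewrite /relax sub0r; set e := expR _.
  have e0 : 0 < e by exact: expR_gt0.
  have Kk : K / (v0 + eps) <= k0 / v0.
    rewrite ler_pdivrMr// mulrAC ler_pdivlMr//.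
    by rewrite ler_pM ?(ltW v0_gt0)// ?ge_max; lra.
  have kK : k0 / v0 - (v0 + k0) / v0 ^+ 2 * eps <= K / (v0 + eps).
    rewrite ler_pdivlMr// [leLHS](_ : _ =
      k0 - eps - (v0 + k0) / v0 ^+ 2 * eps ^+ 2); last by field; exact: lt0r_neq0.
    apply: (@le_trans _ _ (k0 - eps)); last by rewrite le_max lexx.
    by rewrite lerBlDr lerDl !mulr_ge0 ?invr_ge0 ?sqr_ge0// ltW// addr_gt0.
  have : K / (v0 + eps) * e <= k0 / v0 * e by rewrite ler_pM2r.
  lra.
have upper t x : 0 <= t -> eps <> v0 -> m1 t x <=
    (k0 + eps) / (v0 - eps) +
    (u0 + eps - (k0 + eps) / (v0 - eps)) * expR (- (v0 - eps) * t).
  move=> t0 /eqP epsv.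
  apply: (first_moment_le_relax m1P bv ke0 ue0 _ _ x t0).
    by rewrite subr_eq0 eq_sym.
  by move=> y; have [/andP[? _] /andP[_ ?] /andP[_ ?] _] := BP y y; split.
case: (lerP eps (Num.min k0 v0 / 2)) => [small|_].
  exists (- (k0 / v0)), (- ((v0 + k0) / v0 ^+ 2)), (u0 + v0 / 2),
    (2 * (v0 + k0) / v0 ^+ 2); split=> // t x t0; split; first exact: lower.
  move=> /(upper _ x t0); rewrite lerBlDr => /le_trans; apply.
  set e := expR _; have e0 : 0 < e by exact: expR_gt0.
  have ev : eps <= v0 / 2.
    by rewrite (le_trans small)// ler_pM2r ?invr_gt0// ge_min lexx orbT.
  have A0 : 0 <= (k0 + eps) / (v0 - eps) by rewrite divr_ge0//; lra.
  have Ak : (k0 + eps) / (v0 - eps) <=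
      k0 / v0 + 2 * (v0 + k0) / v0 ^+ 2 * eps.
    rewrite ler_pdivrMr; last by lra.
    (* The excess over [k0 + eps] carries the factor [v0 - 2 * eps], nonnegative by [ev]. *)
    rewrite [leRHS](_ : _ = k0 + eps + (v0 + k0) / v0 ^+ 2 * eps * (v0 - 2 * eps));
      last by field; exact: lt0r_neq0.
    rewrite lerDl mulr_ge0 ?mulr_ge0 ?invr_ge0 ?sqr_ge0 ?(ltW eps_gt0)//; lra.
  have : 0 <= (k0 + eps) / (v0 - eps) * e by rewrite mulr_ge0 ?(ltW e0).
  have : (u0 + eps) * e <= (u0 + v0 / 2) * e by rewrite ler_pM2r// lerD2l.
  lra.
(* For larger [eps] the constants may depend on [eps], so the upper ones are read off from [relax]
   exactly. *)
exists (- (k0 / v0)), (- ((v0 + k0) / v0 ^+ 2)),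
  (u0 + eps - (k0 + eps) / (v0 - eps)),
  (((k0 + eps) / (v0 - eps) - k0 / v0) / eps); split=> // t x t0.
split=> [|epsv]; first exact: lower.
rewrite divfK ?lt0r_neq0// addrAC lerD2r; exact: upper.
Qed.
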